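(* Let $G=(V,E,W)$ be an undirected matrix-weighted graph with $n$ vertices $v_1,\ldots,v_n$ and symmetric positive semidefinite matrix weights $\mathbf{A}_{ij}=\mathbf{A}_{ij}^\top=\mathbf{A}_{ji}\in\mathbb{R}^{d\times d}$, and let $\mathbf{M}(G,k)$, $k\ge 0$, be defined as in the context. Then: (i) Two vertices $v_i,v_j\in V$ belong to the same cluster if there exists $k\le n-1$ such that the $ij$-th $d\times d$ block of $\mathbf{M}(G,k)$ satisfies $[\mathbf{M}(G,k)]_{ij}=\mathbf{I}_d$. (ii) The graph $G$ is connected if $\mathbf{M}(G,n-1)=\mathbf{1}_n\mathbf{1}_n^\top\otimes\mathbf{I}_d$. If there is no path joining $v_i$ to $v_j$, then $[\mathbf{M}(G,n-1)]_{ij}=[\mathbf{M}(G,n-1)]_{ji}=\mathbf{0}_{d\times d}$.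
   Context: The graph has no self-loops and no multi-edges. Its block adjacency matrix is $\mathbf{A}=[\mathbf{A}_{ij}]\in\mathbb{R}^{dn\times dn}$ with $\mathbf{A}_{ij}=\mathbf{0}_{d\times d}$ if $(v_i,v_j)\notin E$ or $i=j$. The matrix-weighted Laplacian is $\mathbf{L}=\mathbf{D}-\mathbf{A}$ with $\mathbf{D}=\mathrm{blkdiag}(\mathbf{D}_1,\ldots,\mathbf{D}_n)$, $\mathbf{D}_i=\sum_{j}\mathbf{A}_{ij}$; $G$ is connected if $\mathrm{rank}(\mathbf{L})=dn-d$. Vertices $v_i,v_j$ belong to the same cluster if every $\mathbf{x}=[\mathbf{x}_1^\top,\ldots,\mathbf{x}_n^\top]^\top\in\ker(\mathbf{L})$ satisfies $\mathbf{x}_i=\mathbf{x}_j$. Operations on symmetric positive semidefinite $d\times d$ matrices: series sum $\mathbf{A}_1\vee\mathbf{A}_2=\mathbf{A}_1+\mathbf{A}_2$; parallel sum $\mathbf{A}_1\wedge\mathbf{A}_2=\mathbf{A}_1(\mathbf{A}_1+\mathbf{A}_2)^{\dagger}\mathbf{A}_2$ ($\dagger$ = Moore–Penrose pseudoinverse). Decision operator: $\mathcal{D}(\mathbf{X})=\mathbf{I}_d$ if $\mathrm{rank}(\mathbf{X})=d$, $\mathcal{D}(\mathbf{X})=\mathbf{0}_{d\times d}$ if $\mathbf{X}=\mathbf{0}_{d\times d}$, and $\mathcal{D}(\mathbf{X})=\mathbf{X}$ otherwise; for a block matrix $\mathcal{D}([\mathbf{X}_{ij}])=[\mathcal{D}(\mathbf{X}_{ij})]$.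 For block matrices $\mathbf{X}=[\mathbf{X}_{ij}],\mathbf{Y}=[\mathbf{Y}_{ij}]\in\mathbb{R}^{dn\times dn}$ with $d\times d$ symmetric positive semidefinite blocks: $(\mathbf{X}\wedge\mathbf{Y})_{ij}=\sum_{k=1}^n(\mathbf{X}_{ik}\wedge\mathbf{Y}_{kj})$ and $(\mathbf{X}\vee\mathbf{Y})_{ij}=\mathbf{X}_{ij}+\mathbf{Y}_{ij}$. Powers: $\mathbf{A}^0=\mathbf{I}_{dn}$, $\mathbf{A}^1=\mathcal{D}(\mathbf{A})$, $\mathbf{A}^k=\mathcal{D}(\mathbf{A}^{k-1}\wedge\mathcal{D}(\mathbf{A}))$ for $k\ge2$. Finally $\mathbf{M}(G,0)=\mathbf{I}_{dn}$ and $\mathbf{M}(G,k)=\mathcal{D}(\mathbf{M}(G,k-1)\vee\mathbf{A}^k)$ for $k\ge1$. *)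

(* Defs.v *)
From HB Require Import structures.
From mathcomp Require Import all_boot all_order all_algebra.
From mathcomp Require Import boolp classical_sets reals.

Set Implicit Arguments.
Unset Strict Implicit.
Unset Printing Implicit Defensive.

Import Order.TTheory GRing.Theory Num.Theory.
Local Open Scope ring_scope.

Definition psdmx (R : realType) (d : nat) (X : 'M[R]_d) : Prop :=
  X^T = X /\ forall x : 'cV[R]_d, 0 <= (x^T *m X *m x) 0 0.

(* The four Penrose equations. *)
Definition is_mpinv (R : realType) (m n : nat)
    (X : 'M[R]_(m, n)) (Y : 'M[R]_(n, m)) : Prop :=
  [/\ X *m Y *m X = X, Y *m X *m Y = Y,
      (X *m Y)^T = X *m Y & (Y *m X)^T = Y *m X].

(* Not [pinvmx], which is only a generalized inverse. The default value 0 is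
   never taken, see [mpinvP]. *)
Definition mpinv (R : realType) (m n : nat) (X : 'M[R]_(m, n)) : 'M[R]_(n, m) :=
  xget 0 (fun Y => is_mpinv X Y).

Lemma gram_unit (R : realType) (r n : nat) (F : 'M[R]_(r, n)) :
  row_free F -> F *m F^T \in unitmx.
Proof.
move=> Ff; rewrite -row_free_unit -kermx_eq0; apply/eqP/row_matrixP => i.
rewrite row0; set u := row i _.
have uG : u *m (F *m F^T) = 0.
  by apply/sub_kermxP; rewrite /u row_sub.
have w0 : (u *m F) *m (u *m F)^T = 0.
  by rewrite trmx_mul !mulmxA -(mulmxA u) uG mul0mx.
have uF : u *m F = 0.
  apply/rowP => j; rewrite [RHS]mxE.
  move/matrixP/(_ 0 0): w0; rewrite mxE [RHS]mxE => /eqP.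
  rewrite psumr_eq0 => [/allP/(_ j)|k _]; last by rewrite [_^T _ _]mxE -expr2 sqr_ge0.
  by rewrite mem_index_enum => /(_ isT); rewrite [_^T _ _]mxE mulf_eq0 orbb => /eqP.
by apply: (row_free_inj Ff); rewrite uF mul0mx.
Qed.

Lemma mpinv_exists (R : realType) (m n : nat) (X : 'M[R]_(m, n)) :
  exists Y, is_mpinv X Y.
Proof.
have [r [C [F [XE Cf Ff]]]] : exists r (C : 'M[R]_(m, r)) (F : 'M[R]_(r, n)),
    [/\ X = C *m F, row_free C^T & row_free F].
  exists (\rank X), (col_base X), (row_base X); split; rewrite ?mulmx_base //.
    by rewrite /row_free mxrank_tr; have := col_base_full X.
  exact: row_base_free.
have uF := gram_unit Ff; have := gram_unit Cf; rewrite trmxK => uC.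
set GF := F *m F^T in uF; set GC := C^T *m C in uC.
have GFs : (invmx GF)^T = invmx GF by rewrite trmx_inv trmx_mul trmxK.
have GCs : (invmx GC)^T = invmx GC by rewrite trmx_inv trmx_mul trmxK.
exists (F^T *m invmx GF *m (invmx GC *m C^T)).
have XY : X *m (F^T *m invmx GF *m (invmx GC *m C^T)) = C *m invmx GC *m C^T.
  by rewrite XE !mulmxA -(mulmxA C) -/GF -(mulmxA C) mulmxV // mulmx1.
have YX : F^T *m invmx GF *m (invmx GC *m C^T) *m X = F^T *m invmx GF *m F.
  by rewrite XE !mulmxA -(mulmxA _ C^T) -/GC -(mulmxA _ _ GC) mulVmx // mulmx1.
split.
- by rewrite XY XE !mulmxA -(mulmxA _ C^T) -/GC -(mulmxA _ _ GC) mulVmx // mulmx1.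
- by rewrite YX !mulmxA -(mulmxA _ F) -/GF -(mulmxA _ _ GF) mulVmx // mulmx1.
- by rewrite XY !trmx_mul trmxK GCs !mulmxA.
- by rewrite YX !trmx_mul trmxK GFs !mulmxA.
Qed.

Lemma mpinvP (R : realType) (m n : nat) (X : 'M[R]_(m, n)) :
  is_mpinv X (mpinv X).
Proof. exact: xgetPex (mpinv_exists X). Qed.

Lemma mpinv_uniq (R : realType) (m n : nat) (X : 'M[R]_(m, n)) Y Z :
  is_mpinv X Y -> is_mpinv X Z -> Y = Z.
Proof.
move=> [y1 y2 y3 y4] [z1 z2 z3 z4].
have E1 : X *m Y = X *m Z.
  by rewrite -[LHS]y3 -[in LHS]z1 -mulmxA trmx_mul y3 z3 !mulmxA y1.
have E2 : Y *m X = Z *m X.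
  by rewrite -[LHS]y4 -[in LHS]z1 -!mulmxA mulmxA trmx_mul y4 z4 -!mulmxA [X *m _]mulmxA y1.
by rewrite -y2 E2 -mulmxA E1 mulmxA z2.
Qed.

Definition series_sum (R : realType) (d : nat) (X Y : 'M[R]_d) : 'M[R]_d := X + Y.

Definition parallel_sum (R : realType) (d : nat) (X Y : 'M[R]_d) : 'M[R]_d :=
  X *m mpinv (X + Y) *m Y.

Definition decision (R : realType) (d : nat) (X : 'M[R]_d) : 'M[R]_d :=
  if \rank X == d then 1%:M else if X == 0 then 0 else X.

(* dn x dn matrices, indexed so that they split into n x n blocks of size d. *)
Definition blkmx (R : realType) (n d : nat) : Type := 'M[R]_(\sum_(i < n) d).

Definition block (R : realType) (n d : nat) (X : blkmx R n d) (i j : 'I_n) :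
    'M[R]_d :=
  @submxblock R n n (fun=> d) (fun=> d) X i j.

Definition of_blocks (R : realType) (n d : nat) (B : 'I_n -> 'I_n -> 'M[R]_d) :
    blkmx R n d :=
  \mxblock_(i < n, j < n) B i j.

Definition blk_series (R : realType) (n d : nat) (X Y : blkmx R n d) :
    blkmx R n d :=
  of_blocks (fun i j => series_sum (block X i j) (block Y i j)).

Definition blk_parallel (R : realType) (n d : nat) (X Y : blkmx R n d) :
    blkmx R n d :=
  of_blocks (fun i j => \sum_(k < n) parallel_sum (block X i k) (block Y k j)).

Definition blk_decision (R : realType) (n d : nat) (X : blkmx R n d) :
    blkmx R n d :=
  of_blocks (fun i j => decision (block X i j)).

Fixpoint blk_power (R : realType) (n d : nat) (X : blkmx R n d) (k : nat) :
    blkmx R n d :=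
  match k with
  | 0 => 1%:M
  | 1 => blk_decision X
  | (_.+1 as k').+1 => blk_decision (blk_parallel (blk_power X k') (blk_decision X))
  end.

(* Kronecker product of an n x n matrix with a d x d matrix. *)
Definition kron (R : realType) (n d : nat) (P : 'M[R]_n) (Q : 'M[R]_d) :
    blkmx R n d :=
  of_blocks (fun i j => P i j *: Q).

(* The weight of an edge is allowed to vanish. *)
Record mwgraph (R : realType) (n d : nat) := MWGraph {
  edge : rel 'I_n;
  weight : 'I_n -> 'I_n -> 'M[R]_d;
  edge_sym : symmetric edge;
  edge_irr : irreflexive edge;
  weight_sym : forall i j, weight i j = weight j i;
  weight_psd : forall i j, psdmx (weight i j);
  weight_nonedge : forall i j, ~~ edge i j -> weight i j = 0
}.

Definition adjacency (R : realType) (n d : nat) (G : mwgraph R n d) :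
    blkmx R n d :=
  of_blocks (weight G).

Definition degree (R : realType) (n d : nat) (G : mwgraph R n d) : blkmx R n d :=
  \mxdiag_(i < n) (\sum_(j < n) weight G i j).

Definition laplacian (R : realType) (n d : nat) (G : mwgraph R n d) :
    blkmx R n d :=
  degree G - adjacency G.

Definition mw_connected (R : realType) (n d : nat) (G : mwgraph R n d) : Prop :=
  \rank (laplacian G) = (d * n - d)%N.

Definition same_cluster (R : realType) (n d : nat) (G : mwgraph R n d)
    (i j : 'I_n) : Prop :=
  forall x : 'cV[R]_(\sum_(i < n) d), laplacian G *m x = 0 ->
    @submxcol R n (fun=> d) 1 x i = @submxcol R n (fun=> d) 1 x j.

(* The one-vertex path (p = [::]) joins every vertex to itself. *)
Definition path_joins (R : realType) (n d : nat) (G : mwgraph R n d)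
    (i j : 'I_n) : Prop :=
  exists p : seq 'I_n, [/\ path (edge G) i p, uniq (i :: p) & last i p = j].

Fixpoint Mmx (R : realType) (n d : nat) (G : mwgraph R n d) (k : nat) :
    blkmx R n d :=
  match k with
  | 0 => 1%:M
  | k'.+1 => blk_decision (blk_series (Mmx G k') (blk_power (adjacency G) k))
  end.

(* Main.v *)
(* If x is in the kernel of the Laplacian, its Dirichlet energy
   \sum_(i, j) (x_i - x_j)^T A_ij (x_i - x_j) vanishes, so A_ij kills x_i - x_j.
   The property "the block (i, j) is positive semidefinite and kills x_i - x_j"
   is preserved by the decision operator, by series sums, and, writing
   x_i - x_j = (x_i - x_k) + (x_k - x_j), by parallel sums, since the kernel of
   a parallel sum contains both kernels. Hence it holds for all blocks of
   M(G, k), and a block equal to I_d forces x_i = x_j.  Likewise, the property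
   "the block (i, j) vanishes unless i and j are joined by a path" is preserved
   by all these operations. *)

Require Import Defs.
From mathcomp Require Import all_boot all_order all_algebra.
From mathcomp Require Import reals lra.
Set Implicit Arguments.
Unset Strict Implicit.
Import Order.TTheory GRing.Theory Num.Theory.
Local Open Scope ring_scope.

(** * Positive semidefinite matrices and their isotropic vectors *)

Section PositiveSemidefinite.
Context {R : realType} {d : nat}.
Implicit Types X Y : 'M[R]_d.

Lemma gram_ge0 (y : 'cV[R]_d) : 0 <= (y^T *m y) 0 0.
Proof. by rewrite mxE sumr_ge0 // => k _; rewrite mxE -expr2 sqr_ge0. Qed.

Lemma gram_eq0 (y : 'cV[R]_d) : (y^T *m y) 0 0 = 0 -> y = 0.
Proof.
rewrite mxE => /eqP; rewrite psumr_eq0 => [/allP y0|k _]; last first.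
  by rewrite mxE -expr2 sqr_ge0.
apply/colP => k; rewrite mxE; apply/eqP.
by have := y0 k (mem_index_enum _); rewrite mxE mulf_eq0 orbb.
Qed.

Lemma psdmx0 : psdmx (0 : 'M[R]_d).
Proof. by split=> [|x]; rewrite ?trmx0 // mulmx0 mul0mx mxE. Qed.

Lemma psdmx1 : psdmx (1%:M : 'M[R]_d).
Proof. by split=> [|x]; rewrite ?trmx1 // mulmx1 gram_ge0. Qed.

Lemma psdmxD X Y : psdmx X -> psdmx Y -> psdmx (X + Y).
Proof.
move=> [sX pX] [sY pY]; split=> [|x]; first by rewrite linearD /= sX sY.
by rewrite mulmxDr mulmxDl mxE addr_ge0.
Qed.

Lemma psdmx_congr X (B : 'M[R]_d) : psdmx X -> psdmx (B^T *m X *m B).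
Proof.
move=> [sX pX]; split=> [|x]; first by rewrite !trmx_mul trmxK sX mulmxA.
by rewrite !mulmxA -trmx_mul -mulmxA pX.
Qed.

Lemma psdmx_decision X : psdmx X -> psdmx (decision X).
Proof.
rewrite /decision; case: eqP => [_ _|_]; first exact: psdmx1.
by case: eqP => // _ _; apply: psdmx0.
Qed.

(* The form is nonnegative at x - t (X x) for all t, which for small t > 0
   contradicts X x != 0. *)
Lemma psdmx_isotropic X (x : 'cV[R]_d) :
  psdmx X -> (x^T *m X *m x) 0 0 = 0 -> X *m x = 0.
Proof.
move=> [sX pX] qx; apply: gram_eq0; set y := X *m x.
have xXy : x^T *m X *m y = y^T *m y by rewrite /y trmx_mul sX.
have yXx : y^T *m X *m x = y^T *m y by rewrite -mulmxA.
have [a0 b0] := (gram_ge0 y, pX y).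
set a := (y^T *m y) 0 0 in a0 *; set b := (y^T *m X *m y) 0 0 in b0.
have form_line t : 0 <= t ^+ 2 * b - 2 * t * a.
  have := pX (x - t *: y).
  rewrite [_^T]linearB /= [(t *: y)^T]linearZ /=.
  rewrite !(mulmxBl, mulmxBr) -!(scalemxAl, scalemxAr).
  rewrite xXy yXx /a /b; move: qx.
  move: (x^T *m X *m x) (y^T *m y) (y^T *m X *m y) => M N P.
  by rewrite !mxE => ->; lra.
apply/eqP; rewrite eq_le a0 andbT leNgt; apply/negP => a_gt0.
have b1 : 0 < b + 1 by lra.
(* The minimum over [t] is at [a / b]; the denominator [b + 1] also covers [b = 0]. With
   [a = t * (b + 1)] the form equals [- t ^+ 2 * (b + 2)], which is negative. *)
have := form_line (a / (b + 1)).
have : 0 < a / (b + 1) by rewrite divr_gt0.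
have : a = a / (b + 1) * (b + 1) by rewrite mulfVK // gt_eqF.
move: (a / (b + 1)) => t at_eq t0; rewrite at_eq; nra.
Qed.

End PositiveSemidefinite.

(** * Algebra and kernels of the parallel sum and the decision operator *)

Section ParallelSum.
Context {R : realType} {d : nat}.
Implicit Types X Y : 'M[R]_d.

(** The kernel of [X + Y] lies in that of [X]: two nonnegative forms with zero sum both vanish. The
    columns of [mpinv S *m S - 1%:M], with [S = X + Y], lie in the kernel of [S]. *)
Lemma mulmx_mpinv_addl X Y : psdmx X -> psdmx Y ->
  X *m mpinv (X + Y) *m (X + Y) = X.
Proof.
move=> pX pY; have [S1 _ _ _] := mpinvP (X + Y); set S := X + Y in S1 *.
apply/eqP; rewrite -subr_eq0 -mulmxA -[X in _ - X]mulmx1 -mulmxBr.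
set Q := _ - 1%:M; have SQ : S *m Q = 0 by rewrite mulmxBr mulmxA S1 mulmx1 subrr.
apply/eqP/trmx_inj/row_matrixP => j; rewrite -!tr_col; congr trmx.
rewrite !colE mul0mx -mulmxA; set q := Q *m _.
apply: psdmx_isotropic => //; apply/eqP.
have : (q^T *m X *m q) 0 0 + (q^T *m Y *m q) 0 0 = 0.
  suff <- : (q^T *m S *m q) 0 0 = 0 by rewrite mulmxDr mulmxDl [RHS]mxE.
  by rewrite -mulmxA [S *m q]mulmxA SQ mul0mx mulmx0 mxE.
by move/eqP; rewrite paddr_eq0 ?pX.2 ?pY.2 // => /andP[].
Qed.

Lemma mulmx_mpinv_addr X Y : psdmx X -> psdmx Y ->
  Y *m mpinv (X + Y) *m (X + Y) = Y.
Proof. by move=> pX pY; rewrite [X + Y]addrC mulmx_mpinv_addl. Qed.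

(** Transposition swaps the last two Penrose equations of a symmetric matrix, so uniqueness
    applies. *)
Lemma mpinv_tr (S : 'M[R]_d) : S^T = S -> (mpinv S)^T = mpinv S.
Proof.
move=> sS; have [p1 p2 p3 p4] := mpinvP S.
apply: mpinv_uniq (mpinvP S); split.
- by have := congr1 trmx p1; rewrite !trmx_mul sS mulmxA.
- by have := congr1 trmx p2; rewrite !trmx_mul sS mulmxA.
- by rewrite -[S in S *m _]sS -trmx_mul p4.
- by rewrite -[S in _ *m S]sS -trmx_mul p3.
Qed.

(** Both sides equal [X - X *m mpinv (X + Y) *m X]. *)
Lemma parallel_sumC X Y : psdmx X -> psdmx Y ->
  parallel_sum X Y = parallel_sum Y X.
Proof.
move=> pX pY; rewrite /parallel_sum [Y + X]addrC.
have T1 := mulmx_mpinv_addl pX pY.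
have SSX : (X + Y) *m mpinv (X + Y) *m X = X.
  have := congr1 trmx T1.
  by rewrite !trmx_mul mpinv_tr (psdmxD pX pY).1 // pX.1 mulmxA.
have -> : X *m mpinv (X + Y) *m Y = X - X *m mpinv (X + Y) *m X.
  by rewrite -[X in X - _]T1 mulmxDr addrAC subrr add0r.
have -> : Y *m mpinv (X + Y) *m X = X - X *m mpinv (X + Y) *m X => //.
by rewrite -[X in X - _]SSX !mulmxDl addrAC subrr add0r.
Qed.

(* X (X+Y)^+ Y = B^T X B + C^T Y C with B = (X+Y)^+ Y and C = (X+Y)^+ X. *)
Lemma psdmx_parallel_sum X Y : psdmx X -> psdmx Y -> psdmx (parallel_sum X Y).
Proof.
move=> pX pY; have pS := psdmxD pX pY; have sS := mpinv_tr pS.1.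
have PC := parallel_sumC pX pY.
have T2 := mulmx_mpinv_addr pX pY.
suff -> : parallel_sum X Y =
    (mpinv (X + Y) *m Y)^T *m X *m (mpinv (X + Y) *m Y)
    + (mpinv (X + Y) *m X)^T *m Y *m (mpinv (X + Y) *m X).
  by apply: psdmxD; apply: psdmx_congr.
rewrite !trmx_mul sS pX.1 pY.1.
move: PC; rewrite /parallel_sum [Y + X]addrC => PC.
(* Commutativity gives both summands the left factor [X *m mpinv (X + Y) *m Y *m mpinv (X + Y)];
   their sum collapses by [T2]. *)
by rewrite !mulmxA -PC -mulmxDr [Y + X]addrC -!mulmxA [Y *m _]mulmxA T2.
Qed.

(** The right factor [Y] kills [v]; on [u] it acts as [X + Y], and
    [X *m mpinv (X + Y) *m (X + Y) = X] kills [u]. *)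
Lemma parallel_sum_ker X Y (u v : 'cV[R]_d) : psdmx X -> psdmx Y ->
  X *m u = 0 -> Y *m v = 0 -> parallel_sum X Y *m (u + v) = 0.
Proof.
move=> pX pY Xu Yv; rewrite /parallel_sum mulmxDr -[_ *m v]mulmxA Yv mulmx0 addr0.
have -> : X *m mpinv (X + Y) *m Y *m u = X *m mpinv (X + Y) *m (X + Y) *m u.
  by rewrite -!mulmxA mulmxDl Xu add0r.
by rewrite mulmx_mpinv_addl.
Qed.

Lemma decision_ker X (u : 'cV[R]_d) : X *m u = 0 -> decision X *m u = 0.
Proof.
rewrite /decision; case: eqP => [rX Xu|_]; last by case: eqP => // _; rewrite mul0mx.
have uX : X \in unitmx by rewrite -row_full_unit /row_full rX.
by rewrite mul1mx -(mulKmx uX u) Xu mulmx0.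
Qed.

Lemma decision0 : decision (0 : 'M[R]_d) = 0.
Proof.
rewrite /decision mxrank0 eqxx; case: eqP => // d0.
(* For [d = 0] the zero matrix has full rank and is sent to the identity, but all empty matrices are
   equal. *)
by apply/matrixP => i; move: (ltn_ord i); rewrite -[X in (_ < X)%N]d0.
Qed.

End ParallelSum.

(** * Induction over the blocks of [Mmx] *)

Section Blocks.
Context {R : realType} {n d : nat}.

Lemma block_of_blocks (B : 'I_n -> 'I_n -> 'M[R]_d) i j :
  block (of_blocks B) i j = B i j.
Proof. exact: mxblockK. Qed.

Lemma block1 i j : block (1%:M : blkmx R n d) i j = if i == j then 1%:M else 0.
Proof.
rewrite /block -[1%:M]mxdiagZ /mxdiag mxblockK.
by case: eqP => // _; rewrite conform_mx_id.
Qed.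

(** Common induction for the kernel and the path arguments; the parallel sum composes [P] through a
    middle vertex. *)
Lemma Mmx_block_ind (G : mwgraph R n d) (P : 'I_n -> 'I_n -> 'M[R]_d -> Prop) :
  (forall i, P i i 1%:M) -> (forall i j, P i j 0) ->
  (forall i j, P i j (weight G i j)) ->
  (forall i j X, P i j X -> P i j (decision X)) ->
  (forall i j X Y, P i j X -> P i j Y -> P i j (X + Y)) ->
  (forall i j k X Y, P i k X -> P k j Y -> P i j (parallel_sum X Y)) ->
  forall k i j, P i j (block (Mmx G k) i j).
Proof.
move=> P1 P0 Pw Pd Pp Pl.
have Pid i j : P i j (block (1%:M : blkmx R n d) i j).
  by rewrite block1; case: eqP => [->|_].
have PA i j : P i j (block (blk_decision (adjacency G)) i j).
  by rewrite !block_of_blocks; apply: Pd.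
have Ppow k i j : P i j (block (blk_power (adjacency G) k) i j).
  elim: k i j => [|[|k] IH] i j //.
  rewrite /= !block_of_blocks; apply: Pd.
  by apply: (big_ind (P i j)) => // [X Y|l _]; [apply: Pp | apply: Pl].
elim=> [|k IH] i j //.
by rewrite [Mmx _ _]/= !block_of_blocks; apply/Pd/Pp => //; exact: (Ppow k.+1).
Qed.

End Blocks.

(** * Kernel of the Laplacian, clusters and paths *)

Section Graph.
Context {R : realType} {n d : nat} (G : mwgraph R n d).

Lemma laplacian_mxcol m (y : 'I_n -> 'M[R]_(d, m)) :
  laplacian G *m \mxcol_i y i = \mxcol_i \sum_j weight G i j *m (y i - y j).
Proof.
rewrite mulmxBl mul_mxdiag_mxcol mul_mxblock_mxrow -mxcolB.
apply: eq_mxcol => i; rewrite mulmx_suml -sumrB.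
by apply: eq_bigr => j _; rewrite mulmxBr.
Qed.

Lemma laplacian_ker_weight (y : 'I_n -> 'cV[R]_d) :
  laplacian G *m \mxcol_i y i = 0 ->
  forall i j, weight G i j *m (y i - y j) = 0.
Proof.
rewrite laplacian_mxcol -mxcol0 => /eq_mxcolP Ly i j.
apply: (psdmx_isotropic (weight_psd G i j)).
pose e i j := ((y i - y j)^T *m weight G i j *m (y i - y j)) 0 0.
have e_ge0 k l : 0 <= e k l by apply: (weight_psd G k l).2.
suff E0 : \sum_k \sum_l e k l = 0.
  move/eqP: E0; rewrite psumr_eq0 => [/allP/(_ i (mem_index_enum _))|k _].
    by rewrite psumr_eq0 // => /allP/(_ j (mem_index_enum _)) /eqP.
  exact: sumr_ge0.
(* Half of the energy: summed over [l] it pairs [y k] with block [k] of the Laplacian image, which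
   is zero. *)
pose f k l := ((y k)^T *m weight G k l *m (y k - y l)) 0 0.
have f0 k : \sum_l f k l = 0.
  transitivity (((y k)^T *m \sum_l weight G k l *m (y k - y l)) 0 0).
    by rewrite mulmx_sumr summxE; apply: eq_bigr => l _; rewrite mulmxA.
  by rewrite Ly mulmx0 mxE.
have eE k l : e k l = f k l + f l k.
  rewrite /e /f [_^T]linearB /= !mulmxBl (weight_sym G l k) mxE; congr (_ + _).
  by rewrite -mulmxN opprB.
under eq_bigr do under eq_bigr do rewrite eE.
under eq_bigr do rewrite big_split /= f0 add0r.
by rewrite exchange_big big1.
Qed.

Lemma Mmx_ker (y : 'I_n -> 'cV[R]_d) :
  laplacian G *m \mxcol_i y i = 0 ->
  forall k i j, block (Mmx G k) i j *m (y i - y j) = 0.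
Proof.
move=> Ly k i j.
(* Semidefiniteness is carried along because [parallel_sum_ker] needs it of both operands. *)
pose P i j (X : 'M[R]_d) := psdmx X /\ X *m (y i - y j) = 0.
suff [] : P i j (block (Mmx G k) i j) by [].
apply: Mmx_block_ind => {k}.
- by move=> k; split; [exact: psdmx1 | rewrite subrr mulmx0].
- by move=> k l; split; [exact: psdmx0 | rewrite mul0mx].
- by move=> k l; split; [exact: weight_psd | exact: laplacian_ker_weight].
- by move=> k l X [pX kX]; split; [exact: psdmx_decision | exact: decision_ker].
- by move=> k l X Y [pX kX] [pY kY]; split;
    [exact: psdmxD | rewrite mulmxDl kX kY addr0].
- move=> k l m X Y [pX kX] [pY kY]; split; first exact: psdmx_parallel_sum.
  by rewrite -(subrKA (y m)) parallel_sum_ker.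
Qed.

Lemma Mmx_same_cluster k i j : block (Mmx G k) i j = 1%:M -> same_cluster G i j.
Proof.
move=> M1 x; rewrite -{1}(@submxcolK _ _ (fun=> d) _ x) => Lx.
apply/eqP; rewrite -subr_eq0; apply/eqP.
by have := Mmx_ker Lx k i j; rewrite M1 mul1mx.
Qed.

(** The kernel of the Laplacian is then the column space of [E], a stack of [n] identity blocks, of
    dimension [d]; rank-nullity concludes. *)
Lemma same_cluster_connected : (forall i j, same_cluster G i j) -> mw_connected G.
Proof.
rewrite /mw_connected; have sz : (\sum_(i < n) d = d * n)%N.
  by rewrite sum_nat_const card_ord mulnC.
have := rank_leq_row (laplacian G); rewrite [in leqRHS]sz => rL.
have [n0|n0] := posnP n.
  (* Without vertices the truncated difference is 0, like the rank. *)
  move=> _; apply/eqP; have -> : (d * n - d = 0)%N by rewrite [in LHS]n0 muln0.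
  by rewrite -leqn0; apply: leq_trans rL _; rewrite [in leqLHS]n0 muln0.
move=> clG; pose E : 'M[R]_(\sum_(i < n) d, d) := \mxcol_(i < n) 1%:M.
have i0 : 'I_n := Ordinal n0.
have LE : laplacian G *m E = 0.
  rewrite laplacian_mxcol -[RHS]mxcol0; apply: eq_mxcol => i.
  by rewrite big1 // => j _; rewrite subrr mulmx0.
have rE : \rank E^T = d.
  apply/eqP/row_freeP; exists (\mxcol_(i < n) ((i == i0)%:R%:M : 'M[R]_d)).
  rewrite tr_mxcol mul_mxrow_mxcol (bigD1 i0) //= eqxx trmx1 mul1mx.
  by rewrite big1 ?addr0 // => i /negPf->; rewrite raddf0 mulmx0.
have KE : (kermx (laplacian G)^T == E^T)%MS.
  apply/andP; split; last by apply/sub_kermxP; rewrite -trmx_mul LE trmx0.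
  apply/row_subP => k; set v := row k _.
  have Lv : laplacian G *m v^T = 0.
    apply: trmx_inj; rewrite trmx_mul trmxK trmx0.
    by apply/sub_kermxP; rewrite row_sub.
  (* All blocks of a kernel vector agree with block [i0], which thus gives the coefficients. *)
  apply/submxP; exists (@submxcol R n (fun=> d) 1 v^T i0)^T.
  apply: trmx_inj; rewrite trmx_mul !trmxK mxcol_mul.
  rewrite -[LHS](@submxcolK _ _ (fun=> d)); apply: eq_mxcol => i.
  by rewrite mul1mx (clG i i0).
have := mxrank_ker (laplacian G)^T.
rewrite (eqmx_rank KE) rE mxrank_tr [X in (X - _)%N]sz => dE.
by rewrite [X in (_ - X)%N]dE subKn.
Qed.

Lemma Mmx_disconnected k i j :
  ~~ connect (edge G) i j -> block (Mmx G k) i j = 0.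
Proof.
pose P i j (X : 'M[R]_d) := ~~ connect (edge G) i j -> X = 0.
apply: (@Mmx_block_ind _ _ _ G P) => {k i j} //.
- by move=> i; rewrite /P connect0.
- by move=> i j nc; apply: weight_nonedge; apply: contra nc; apply: connect1.
- by move=> i j X PX nc; rewrite PX // decision0.
- by move=> i j X Y PX PY nc; rewrite PX // PY // addr0.
- move=> i j k X Y PX PY nc; rewrite /parallel_sum.
  (* Either a factor vanishes, or [i] reaches [j] through [k], a contradiction. *)
  have [ik|/PX->] := boolP (connect (edge G) i k); last by rewrite !mul0mx.
  have [kj|/PY->] := boolP (connect (edge G) k j); last by rewrite mulmx0.
  by rewrite (connect_trans ik kj) in nc.
Qed.

(** Cutting the loops out of a walk leaves a simple path. *)
Lemma path_joinsP i j : reflect (path_joins G i j) (connect (edge G) i j).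
Proof.
apply: (iffP connectP) => [[p ep ->]|[p [ep _ <-]]]; last by exists p.
by case: (shortenP ep) => p' ep' up' _; exists p'.
Qed.

End Graph.

Theorem theorem2 (R : realType) (n d : nat) (G : mwgraph R n d) :
  (forall i j : 'I_n,
     (exists k : nat, (k <= n.-1)%N /\ block (Mmx G k) i j = 1%:M) ->
     same_cluster G i j)
  /\
  ((Mmx G n.-1 = kron ((const_mx 1 : 'cV[R]_n) *m (const_mx 1 : 'cV[R]_n)^T)
                      (1%:M : 'M[R]_d) ->
    mw_connected G)
   /\
   (forall i j : 'I_n, ~ path_joins G i j ->
      block (Mmx G n.-1) i j = 0 /\ block (Mmx G n.-1) j i = 0)).
Proof.
split=> [i j [k [_ Mk]]|]; first exact: (@Mmx_same_cluster _ _ _ G k).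
split=> [M1|i j /path_joinsP nij].
  apply: same_cluster_connected => i j; apply: (@Mmx_same_cluster _ _ _ G n.-1).
  by rewrite M1 block_of_blocks !mxE big_ord1 !mxE mulr1 scale1r.
by split; apply: Mmx_disconnected; rewrite // (sym_connect_sym (edge_sym G)).
Qed.
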